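(* Let $G$ be a finite $p$-solvable group, where $p$ is the smallest prime dividing the order of $G$. Every maximal subgroup of $G$ has index not divisible by $p^2$ if and only if $G$ has a normal $p$-complement.
   Context: A finite group is $p$-solvable if each of its composition factors is either of order $p$ or of order prime to $p$. A normal $p$-complement of $G$ is a normal subgroup of $G$ whose order is prime to $p$ and whose index is a power of $p$. *)

(* Defs.v *)
From mathcomp Require Import all_boot all_fingroup all_solvable.

Set Implicit Arguments.
Unset Strict Implicit.
Unset Printing Implicit Defensive.

Local Open Scope group_scope.

(* [comps G s] says that [s] lists a composition series of [G] from the top
   down, omitting [G] itself; the consecutive quotients of [G :: s] are then
   the composition factors. Every composition series is considered, so this
   does not rely on the Jordan-Hoelder theorem, and [exists_comps] shows that
   the quantification over [s] is not vacuous. *)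
Definition composition_factor (gT : finGroupType) (G : {group gT})
    (F : section gT) : Prop :=
  exists2 s : seq {group gT}, comps G s & F \in pairmap (@mkSec gT) G s.

(* [#|F|] is the order of the quotient group to which [F] coerces. *)
Definition p_solvable (gT : finGroupType) (p : nat) (G : {group gT}) : Prop :=
  forall F : section gT,
    composition_factor G F -> #|F| = p \/ coprime #|F| p.

Definition normal_p_complement (gT : finGroupType) (p : nat)
    (K G : {group gT}) : Prop :=
  [/\ K <| G, coprime #|K| p & exists n : nat, #|G : K| = (p ^ n)%N].

(* Main.v *)
(* A maximal subgroup M either contains the normal p-complement, and then has
   index p, or supplements it, and then has index prime to p.

   Conversely, induct on #|G|. Let N be minimal normal in G and K / N a normal
   p-complement of G / N. If N is a p'-group then K works. Otherwise N is an
   abelian p-group, K = N H with H a p'-group, and the Frattini argument gives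
   G = N 'N_G(H). If H is not normal in G, a maximal M above 'N_G(H) satisfies
   N M = G and N :&: M = 1, so its index #|N| must be p; as p is the smallest
   prime divisor of #|G|, N is then central, so it normalizes H after all. *)

Require Import Defs.
From mathcomp Require Import all_boot all_fingroup all_solvable.

Set Implicit Arguments.
Unset Strict Implicit.
Unset Printing Implicit Defensive.

Local Open Scope group_scope.

(** Take [M] maximal among the proper normal subgroups of [G] that contain [N]. Then [G / M] is
    simple and [N] is still normal in [M], so the series grows downwards from [G] by induction on
    the order. *)
Lemma comps_through_normal (gT : finGroupType) (N G : {group gT}) t :
  N <| G -> comps N t -> exists r, comps G (r ++ t) /\ last G r = N.
Proof.
have [n] := ubnP #|G|; elim: n G => // n IHn G /ltnSE-leGn nsNG cNt.
have [<- | neNG] := eqVneq N G; first by exists [::].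
have ltNG : N \proper G.
  by rewrite properEneq normal_sub // andbT; apply: contraNneq neNG => /group_inj->.
have [|M maxM sNM] := @maxgroup_exists _ (fun L => (L \proper G) && (G \subset 'N(L))) N.
  by rewrite ltNG normal_norm.
have ltMG : M \proper G by case/andP: (maxgroupp maxM).
have [||r [cMr lr]] := IHn M _ _ cNt.
- exact: leq_trans (proper_card ltMG) leGn.
- exact: normalS sNM (proper_sub ltMG) nsNG.
exists (M :: r); split=> //.
by case/andP: cMr => lMr cMr; apply/and3P.
Qed.

(* Unlike [p_solvable], this form passes to quotients by the third isomorphism
   theorem alone. *)
Definition p_solvable_heads {gT : finGroupType} (p : nat) (G : {group gT}) : Prop :=
  forall H M : {group gT}, H <| G -> M <| H -> simple (H / M) ->
    #|H : M| = p \/ coprime #|H : M| p.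

(** A composition series of [M], headed by [H] and extended upwards to [G], exhibits [H / M] as a
    composition factor of [G]. *)
Lemma p_solvable_has_p_solvable_heads (gT : finGroupType) (p : nat) (G : {group gT}) :
  p_solvable p G -> p_solvable_heads p G.
Proof.
move=> solG H M nsHG nsMH simHM.
have [t cMt] := exists_comps M.
have cHt : comps H (M :: t).
  case/andP: cMt => lt ct; apply/and3P; split=> //=.
  by rewrite -quotient_simple.
have [r [cGr lr]] := @comps_through_normal _ H G _ nsHG cHt.
have /solG : composition_factor G (mkSec H M).
  exists (r ++ M :: t) => //.
  by rewrite pairmap_cat mem_cat lr /= inE eqxx orbT.
by rewrite /= card_quotient ?normal_norm.
Qed.

Lemma p_solvable_heads_quotient (gT : finGroupType) (p : nat) (G N : {group gT}) :
  N <| G -> p_solvable_heads p G -> p_solvable_heads p (G / N)%G.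
Proof.
move=> nsNG solG H M nsHG nsMH simHM.
have nsH : coset N @*^-1 H <| G by rewrite -(quotientGK nsNG) cosetpre_normal.
have nsM : coset N @*^-1 M <| coset N @*^-1 H by rewrite cosetpre_normal.
have := solG _ _ nsH nsM; rewrite index_cosetpre; apply.
have nsNM : N <| coset N @*^-1 M by rewrite normal_cosetpre.
have nsNH : N <| coset N @*^-1 H by rewrite normal_cosetpre.
have defH : H = (coset N @*^-1 H / N)%G by apply/group_inj; rewrite /= cosetpreK.
have defM : M = (coset N @*^-1 M / N)%G by apply/group_inj; rewrite /= cosetpreK.
rewrite defH defM in simHM.
by rewrite -(isog_simple (third_isog (normal_sub nsNM) nsNH nsM)).
Qed.

(** A single simple quotient [N / M] decides the case, because minimality makes any suitably
    invariant subgroup of [N] that lies in [M] trivial: the derived subgroup if [N / M] has order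
    [p], the subgroup generated by the [p]-elements if its order is prime to [p]. *)
Lemma minnormal_p_solvable (gT : finGroupType) (p : nat) (G N : {group gT}) :
  prime p -> p_solvable_heads p G -> N <| G -> minnormal N G ->
  (p.-group N /\ abelian N) \/ p^'.-group N.
Proof.
move=> p_pr solG nsNG minN.
have /charsimpleP[ntN simN] := minnormal_charsimple minN.
have [M maxM] := ex_maxnormal_ntrivg ntN.
have nsMN := maxnormal_normal maxM.
have ltMN := maxnormal_proper maxM.
case: (solG N M nsNG nsMN); first by rewrite quotient_simple.
  move=> oNM; left.
  have abN : abelian N.
    apply: contraLR ltMN => /derG1P/eqP ntN'; rewrite properE negb_and negbK.
    apply/orP; right; rewrite -{1}(simN _ ntN' (der_char 1 N)).
    rewrite der1_min ?normal_norm //.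
    rewrite cyclic_abelian ?prime_cyclic // card_quotient ?normal_norm //.
    by rewrite oNM.
  split=> //.
  have /is_abelemP[q q_pr abelN] : is_abelem N.
    apply: charsimple_solvable (abelian_sol abN).
    exact: minnormal_charsimple minN.
  have /pgroupP qN := abelem_pgroup abelN.
  have /(qN p p_pr) : p %| #|N| by rewrite -oNM dvdn_indexg.
  by rewrite inE => /eqP->; apply: abelem_pgroup abelN.
move=> co_p; right.
(* [R] is the residual O^{p'}(N). *)
pose R := <<[set x in N | p.-elt x]>>%G.
have sRN : R \subset N by rewrite gen_subG; apply/subsetP=> x; rewrite inE => /andP[].
have nRG : G \subset 'N(R).
  apply: norms_gen; apply/normsP=> g Gg; apply/setP=> x.
  rewrite mem_conjg !inE p_eltJ memJ_norm // groupV.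
  exact: (subsetP (normal_norm nsNG)).
have sRM : R \subset M.
  rewrite gen_subG; apply/subsetP=> x; rewrite inE => /andP[Nx px].
  have nMx : x \in 'N(M) := subsetP (normal_norm nsMN) x Nx.
  (* The image of [x] in [N / M] has order a power of [p] that divides [#|N : M|], hence order 1. *)
  apply: coset_idr => //; apply/eqP; rewrite -order_eq1 -dvdn1.
  have pMx : p.-nat #[coset M x] := morph_p_elt (coset_morphism M) nMx px.
  have /p_natP[k oMx] := pMx.
  have /eqP <- : coprime #|N : M| (p ^ k) by rewrite coprimeXr.
  by rewrite -oMx dvdn_gcd dvdnn andbT -card_quotient ?normal_norm // order_dvdG ?mem_quotient.
have [_ minN_G] := mingroupP minN.
have [R1 | ntR] := eqVneq (R : {set gT}) 1; last first.
  have defR : R = N :> {set gT} by apply: minN_G; rewrite // ntR.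
  by move: ltMN; rewrite properE -{2}defR sRM andbF.
rewrite /pgroup p'natE //; apply/negP=> /(Cauchy p_pr)[x Nx ox].
have : x \in R by rewrite mem_gen // inE Nx /p_elt ox pnat_id.
by rewrite R1 => /set1P x1; move: p_pr; rewrite -ox x1 order1.
Qed.

(** The class of a nontrivial [x] in [N] lies in [N^#], so it has fewer than [p] elements. Its size
    divides [#|G|], and a size above 1 would have a prime divisor smaller than [p]. *)
Lemma normal_order_min_prime_central (gT : finGroupType) (p : nat)
    (G N : {group gT}) :
    (forall q : nat, prime q -> q %| #|G| -> p <= q) ->
  N <| G -> #|N| = p -> N \subset 'C(G).
Proof.
move=> p_min nsNG oN; apply/subsetP=> x Nx.
have [-> | ntx] := eqVneq x 1; first exact: group1.
have sxN : x ^: G \subset N^#.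
  apply/subsetP=> _ /imsetP[g Gg ->].
  by rewrite !inE conjg_eq1 ntx memJ_norm // (subsetP (normal_norm nsNG)).
have ltp : #|x ^: G| < p.
  by rewrite -oN (cardsD1 1 N) group1 ltnS subset_leq_card.
rewrite -sub_cent1 -indexg_eq1 -indexgI index_cent1.
apply: contraTT ltp => ntGx; rewrite -leqNgt.
have lt1 : 1 < #|x ^: G| by rewrite ltn_neqAle eq_sym ntGx -index_cent1 indexg_gt0.
apply: leq_trans (pdiv_leq (ltnW lt1)).
apply: p_min (pdiv_prime lt1) _.
apply: dvdn_trans (pdiv_dvd _) _.
by rewrite -index_cent1 dvdn_indexg.
Qed.

Lemma normal_p_complementP (gT : finGroupType) (p : nat) (K G : {group gT}) :
  prime p -> normal_p_complement p K G <-> K <| G /\ p^'.-Hall(G) K.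
Proof.
move=> p_pr; rewrite /pHall /normal_p_complement /pgroup pnatNK.
rewrite p'natE // coprime_sym prime_coprime //.
split=> [[nsKG coK [n ->]] | [nsKG /and3P[_ coK /p_natP[n ->]]]].
  by split; rewrite // normal_sub // coK pnatX pnat_id.
by split=> //; exists n.
Qed.

Lemma index_mulg (gT : finGroupType) (N M G : {group gT}) :
  N * M = G -> #|G : M| = #|N : M|.
Proof.
move=> defG; have sMG : M \subset G by rewrite -defG mulG_subr.
apply/eqP; rewrite -(eqn_pmul2l (cardG_gt0 M)) Lagrange //.
by rewrite mulnC LagrangeMr defG.
Qed.

Lemma normal_p_complement_maximal_index (gT : finGroupType) (p : nat)
    (K G M : {group gT}) :
    prime p -> K <| G -> p^'.-Hall(G) K -> maximal M G ->
  ~~ (p ^ 2 %| #|G : M|).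
Proof.
move=> p_pr nsKG hallK maxM.
have [sKM | not_sKM] := boolP (K \subset M).
  have nsKM : K <| M := normalS sKM (proper_sub (maxgroupp maxM)) nsKG.
  have pGK : p.-group (G / K).
    by rewrite /pgroup card_quotient ?normal_norm // -(pnatNK p); case/and3P: hallK.
  have maxMK : maximal (M / K) (G / K) by rewrite quotient_maximal.
  have := p_maximal_index pGK maxMK.
  rewrite index_quotient_eq ?subIset ?sKM ?orbT ?normal_norm //; last first.
    exact: proper_sub (maxgroupp maxM).
  by move=> ->; rewrite -[X in _ %| X]expn1 (dvdn_Pexp2l _ _ (prime_gt1 p_pr)).
have defG : K * M = G.
  have sMG := proper_sub (maxgroupp maxM).
  have nKM := subset_trans sMG (normal_norm nsKG).
  rewrite -norm_joinEr //; have /maxgroupP[_ maxM'] := maxM.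
  apply/eqP; rewrite eqEproper join_subG normal_sub // sMG /=.
  by apply: contra not_sKM => /maxM' <-; rewrite ?joing_subl ?joing_subr.
rewrite (index_mulg defG); apply: contraL (pHall_pgroup hallK) => p2KM.
rewrite /pgroup p'natE // negbK (dvdn_trans _ (dvdn_indexg K M)) //.
by apply: dvdn_trans p2KM; rewrite expnS dvdn_mulr.
Qed.

(* Every [H :^ g] is again a complement of [N] in [K], so by Schur-Zassenhaus it
   is [H :^ x] for some [x] in [N]. *)
Lemma abelian_complement_Frattini (gT : finGroupType) (G K N H : {group gT}) :
    N <| G -> K <| G -> abelian N -> N * H = K -> coprime #|N| #|H| ->
  N * 'N_G(H) = G.
Proof.
move=> nsNG nsKG abN defK coNH.
have sHK : H \subset K by rewrite -defK mulG_subr.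
have [sNG nNG] := andP nsNG; have [sKG nKG] := andP nsKG.
rewrite setIC group_modl //; apply/setIidPr/subsetP=> g Gg.
have [||||x Nx eHx] := @SchurZassenhaus_trans_sol _ N H (H :^ g^-1) (abelian_sol abN).
- exact: subset_trans (subset_trans sHK sKG) nNG.
- by rewrite /= defK -(normsP nKG _ (groupVr Gg)) conjSg.
- exact: coNH.
- by rewrite cardJg.
(* Since [H :^ g^-1 = H :^ x], the product [x * g] normalizes [H]. *)
rewrite -(mulKg x g) mem_mulg ?groupV //.
by apply/normP; rewrite conjsgM -eHx conjsgKV.
Qed.

Lemma maximal_index_normal_p_complement (gT : finGroupType) (G : {group gT})
    (p : nat) :
    prime p -> (forall q : nat, prime q -> q %| #|G| -> p <= q) ->
    p_solvable_heads p G ->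
    (forall M : {group gT}, maximal M G -> ~~ (p ^ 2 %| #|G : M|)) ->
  exists2 K : {group gT}, K <| G & p^'.-Hall(G) K.
Proof.
have [n] := ubnP #|G|; elim: n gT G => // n IHn gT G /ltnSE-leGn.
move=> p_pr p_min solG maxG.
have [G1 | ntG] := eqVneq (G : {set gT}) 1.
  exists G; rewrite ?normal_refl // pHallE subxx /= G1 cards1 part_pnat_id //.
have [N minN sNG] := minnormal_exists ntG (normG G).
have /andP[ntN nNG] := mingroupp minN.
have nsNG : N <| G by apply/andP.
have [||||Kb nsKb hallKb] := IHn _ (G / N)%G _ p_pr.
- exact: leq_trans (ltn_quotient ntN sNG) leGn.
- by move=> q q_pr qG; apply: p_min q_pr (dvdn_trans qG (dvdn_quotient _ _)).
- exact: p_solvable_heads_quotient.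
- move=> M maxM; rewrite -index_cosetpre quotientGK //; apply: maxG.
  by rewrite -(quotientGK nsNG) cosetpre_maximal.
have [K defKb sNK nsKG] := inv_quotientN nsNG nsKb.
have nsNK : N <| K := normalS sNK (normal_sub nsKG) nsNG.
have p'KN : p^'.-group (K / N) by rewrite -defKb (pHall_pgroup hallKb).
have piGK : p.-nat #|G : K|.
  have /and3P[_ _] := hallKb; rewrite pnatNK defKb.
  by rewrite index_quotient_eq ?(normal_sub nsKG) // subIset ?sNK ?orbT.
have [[pN abN] | p'N] := minnormal_p_solvable p_pr solG nsNG minN; last first.
  exists K => //; apply/and3P; split; rewrite ?normal_sub ?pnatNK //.
  by rewrite /pgroup -(Lagrange sNK) pnatM -card_quotient ?normal_norm //; apply/andP.
have hallN : p.-Hall(K) N.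
  by apply/and3P; split; rewrite // -card_quotient ?normal_norm.
have /splitsP[H] := SchurZassenhaus_split (pHall_Hall hallN) nsNK.
rewrite (compl_pHall _ hallN) => hallH.
have /complP[tiNH defK] : H \in [complements to N in K] by rewrite (compl_pHall _ hallN).
have coNH : coprime #|N| #|H| := pnat_coprime pN (pHall_pgroup hallH).
have sHG : H \subset G := subset_trans (pHall_sub hallH) (normal_sub nsKG).
have hallHG : p^'.-Hall(G) H.
  apply/and3P; split; rewrite ?(pHall_pgroup hallH) ?sHG //.
  rewrite -(Lagrange_index (normal_sub nsKG) (pHall_sub hallH)) pnatM.
  by rewrite !pnatNK piGK; case/and3P: hallH => _ _; rewrite pnatNK.
have FrG := abelian_complement_Frattini nsNG nsKG abN defK coNH.
exists H => //; rewrite /normal sHG /=.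
have [/= defN | [M maxM sNM]] := @maximal_exists _ 'N_G(H) G (subsetIl G _).
  by rewrite -{1}defN subsetIr.
have sMG : M \subset G := proper_sub (maxgroupp maxM).
have defNM : N * M = G by apply/eqP; rewrite eqEsubset mul_subG // -{1}FrG mulgS.
have tiNM : N :&: M = 1.
  have [//|ntNM] := eqVneq (N :&: M) 1.
  have nNM : G \subset 'N(N :&: M).
    (* [N] normalizes the intersection because it is abelian, and [M] because it normalizes [N]. By
       minimality a nontrivial intersection is all of [N], and then [G = N * M] lies in [M]. *)
    rewrite -{1}defNM mul_subG ?(sub_abelian_norm abN) ?subsetIl //.
    by rewrite normsI ?normG // (subset_trans sMG).
  have [_ /(_ (N :&: M)%G)] := mingroupP minN.
  rewrite /= ntNM nNM => /(_ isT (subsetIl _ _)) defI.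
  case/andP: (maxgroupp maxM) => _ /negP[]; rewrite -defNM mul_subG //.
  by rewrite -defI subsetIr.
have oN : #|N| = p.
  have oGM : #|G : M| = #|N| by rewrite (index_mulg defNM) -indexgI tiNM indexg1.
  have := maxG M maxM; rewrite oGM.
  have [_ _ [k ->]] := pgroup_pdiv pN ntN.
  (* Here [#|N|] is [p ^ k.+1], which [p ^ 2] divides unless [k = 0]. *)
  by case: k => // k; rewrite dvdn_exp2l.
have cNG := normal_order_min_prime_central p_min nsNG oN.
rewrite -{1}FrG mul_subG ?subsetIr //.
by rewrite cents_norm // (subset_trans cNG) // centS.
Qed.

Theorem theorem1p2 (gT : finGroupType) (G : {group gT}) (p : nat)
    (p_pr : prime p) (p_dvd_G : (p %| #|G|)%N)
    (p_min : forall q : nat, prime q -> (q %| #|G|)%N -> (p <= q)%N)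
    (p_sol : p_solvable p G) :
  (forall M : {group gT}, maximal M G -> ~~ (p ^ 2 %| #|G : M|)%N)
  <-> (exists K : {group gT}, normal_p_complement p K G).
Proof.
split=> [maxG | [K /(normal_p_complementP _ _ p_pr)[nsKG hallK]] M maxM].
  have solG := p_solvable_has_p_solvable_heads p_sol.
  have [K nsKG hallK] := maximal_index_normal_p_complement p_pr p_min solG maxG.
  by exists K; apply/normal_p_complementP.
exact: normal_p_complement_maximal_index hallK maxM.
Qed.
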